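(* Let $X$ be a real Banach space, $g:[a,b]\to X$, $x\in[a,b]$, and suppose that $md(g,x)>0$ and $md(g,\cdot)$ is continuous at $x$. Then $x$ is a metrically regular point of the function $g$.
   Context: For $g:[a,b]\to X$, the unilateral metric derivatives are $md_{\pm}(g,x)=\lim_{t\to0+}\frac{\|g(x\pm t)-g(x)\|}{t}$. If both exist and are equal (and finite), their common value is the metric derivative $md(g,x)$; at an endpoint of $[a,b]$ only the one-sided limit taken inside $[a,b]$ is used. ''$md(g,\cdot)$ is continuous at $x$'' means that $md(g,s)$ exists for all $s\in[a,b]$ in some neighbourhood of $x$ and $md(g,s)\to md(g,x)$ as $s\to x$, $s\in[a,b]$. $\bigvee_u^v g$ denotes the total variation of $g$ on $[u,v]$ for $u<v$, and $\bigvee_v^u g:=-\bigvee_u^v g$. A point $x\in[a,b]$ is a metrically regular point of $g$ if $\lim_{t\to0,\ x+t\in[a,b]}\frac{\|g(x+t)-g(x)\|}{\left|\bigvee_x^{x+t}g\right|}=1$ (in particular the denominator is nonzero for all small $t\neq0$). *)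

(* Defs.v *)
From HB Require Import structures.
From mathcomp Require Import all_boot all_order all_algebra.
From mathcomp Require Import all_classical all_reals all_analysis.

Set Implicit Arguments.
Unset Strict Implicit.
Unset Printing Implicit Defensive.

Import Order.TTheory GRing.Theory Num.Theory.
Import numFieldTopology.Exports numFieldNormedType.Exports.

Local Open Scope classical_set_scope.
Local Open Scope ring_scope.

(* A function [a, b] -> X is represented by a total function R -> X together
   with a and b; none of the notions below depends, for points of [a, b], on
   the values taken outside [a, b]. *)

Definition is_md_right {R : realType} {X : normedModType R}
    (g : R -> X) (x L : R) : Prop :=
  (fun t : R => `|g (x + t) - g x| / t) @ 0^'+ --> L.

Definition is_md_left {R : realType} {X : normedModType R}
    (g : R -> X) (x L : R) : Prop :=
  (fun t : R => `|g (x - t) - g x| / t) @ 0^'+ --> L.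

(* At an endpoint only the one-sided limit taken inside [a, b] is required. *)
Definition is_md {R : realType} {X : normedModType R}
    (a b : R) (g : R -> X) (x L : R) : Prop :=
  [/\ x \in `[a, b],
      (a < x -> is_md_left g x L) &
      (x < b -> is_md_right g x L)].

Definition has_md {R : realType} {X : normedModType R}
    (a b : R) (g : R -> X) (x : R) : Prop :=
  exists L : R, is_md a b g x L.

(* Meaningful only when has_md a b g x holds (the limit is then unique as soon
   as a < b). *)
Definition md {R : realType} {X : normedModType R}
    (a b : R) (g : R -> X) (x : R) : R :=
  get [set L | is_md a b g x L].

Definition md_continuous_at {R : realType} {X : normedModType R}
    (a b : R) (g : R -> X) (x : R) : Prop :=
  (\forall s \near within `[a, b] (nbhs x), has_md a b g s) /\
  md a b g s @[s --> within `[a, b] (nbhs x)] --> md a b g x.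

(* Same definitions as the library's variation and total_variation, which are
   restricted to real-valued functions. *)
Definition nvariation {R : realType} {X : normedModType R}
    (u v : R) (g : R -> X) (s : seq R) : R :=
  let F := g \o nth v (u :: s) in
  \sum_(0 <= n < size s) `|F n.+1 - F n|.

Definition total_nvariation {R : realType} {X : normedModType R}
    (u v : R) (g : R -> X) : \bar R :=
  ereal_sup [set (nvariation u v g s)%:E | s in itv_partition u v].

Definition signed_nvariation {R : realType} {X : normedModType R}
    (u v : R) (g : R -> X) : \bar R :=
  if u <= v then total_nvariation u v g else (- total_nvariation v u g)%E.

(* The first conjunct says that the real quotient in the second one is
   genuine: its denominator is finite and nonzero for all small t != 0. *)
Definition metrically_regular {R : realType} {X : normedModType R}
    (a b : R) (g : R -> X) (x : R) : Prop :=
  let V t := signed_nvariation x (x + t) g in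
  let F := within [set t : R | x + t \in `[a, b]] 0^' in
  (\forall t \near F, V t \is a fin_num /\ V t != 0%E) /\
  `|g (x + t) - g x| / `|fine (V t)| @[t --> F] --> (1 : R).

(* Main.v *)
Require Import Defs.
From HB Require Import structures.
From mathcomp Require Import all_boot all_order all_algebra.
From mathcomp Require Import all_classical all_reals all_analysis.
From mathcomp Require Import lra.

Import Order.TTheory GRing.Theory Num.Theory.
Import numFieldTopology.Exports numFieldNormedType.Exports.

Local Open Scope classical_set_scope.
Local Open Scope ring_scope.

(* Write L for md(g, x).  Near x all metric derivatives are below L + d, and a
   supremum argument turns this pointwise bound into a Lipschitz bound for g
   with constant L + d; hence the variation of g between x and x + t is at most
   (L + d) |t|.  It is at least |g (x + t) - g x| >= (L - d) |t|, so the
   quotient lies in [(L - d) / (L + d), 1] for all small t. *)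

(** Trades a one-sided limit for an explicit radius and bounds free of division, the form used for
    both unilateral derivatives. *)
Lemma cvg_quotient_at_right_bounds {R : realType} {h : R -> R} {k L K : R} :
  (fun t : R => h t / t) @ 0^'+ --> L -> k < L < K ->
  exists2 e : R, 0 < e & forall t, 0 < t < e -> k * t <= h t <= K * t.
Proof.
move=> hL kLK.
have : \forall t \near (0 : R)^'+, h t / t \in `]k, K[.
  by apply: (hL [set y | y \in `]k, K[]); apply: near_in_itvoo; rewrite in_itv.
rewrite near_withinE => /nbhs_ballP[e /= e0 he]; exists e => // t /andP[t0 te].
have /he : ball (0 : R) e t by rewrite /ball/= sub0r normrN gtr0_norm.
move=> /(_ t0); rewrite in_itv /= => /andP[/ltW lo /ltW hi].
by rewrite -ler_pdivlMr// lo -ler_pdivrMr.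
Qed.

(** Let [A] be the set of points up to which the bound from [u] holds. The left bound at [sup A]
    puts [sup A] in [A]; if [sup A < v], the right bound there would extend [A] further. *)
Lemma locally_lipschitz_le (R : realType) (X : normedModType R) (g : R -> X)
    (K u v : R) : u <= v ->
  (forall s, u <= s < v -> exists2 e : R, 0 < e &
     forall t, 0 < t < e -> `|g (s + t) - g s| <= K * t) ->
  (forall s, u < s <= v -> exists2 e : R, 0 < e &
     forall t, 0 < t < e -> `|g (s - t) - g s| <= K * t) ->
  `|g v - g u| <= K * (v - u).
Proof.
move=> uv hr hl.
pose A := [set s : R | u <= s <= v /\ `|g s - g u| <= K * (s - u)].
have Au : A u by split; rewrite ?lexx ?uv// !subrr normr0 mulr0.
have ubA : ubound A v by move=> s [/andP[]].
have supA : has_sup A by split; [exists u|exists v].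
have uc : u <= sup A by apply: ub_le_sup => //; exists v.
have cv : sup A <= v by apply: ge_sup => //; exists u.
have step s t : `|g s - g u| <= K * (s - u) -> `|g t - g s| <= K * (t - s) ->
    `|g t - g u| <= K * (t - u).
  move=> h1 h2; have := ler_distD (g s) (g t) (g u); nra.
have Ac : `|g (sup A) - g u| <= K * (sup A - u).
  move: uc; rewrite le_eqVlt => /predU1P[<-|uc].
    by rewrite !subrr normr0 mulr0.
  have [|e e0 he] := hl (sup A); first by rewrite uc cv.
  have [s As es] := sup_adherent e0 supA.
  have sc : s <= sup A by apply: ub_le_sup => //; exists v.
  case: As => _ As; apply: step As _.
  move: sc; rewrite le_eqVlt => /predU1P[<-|sc].
    by rewrite !subrr normr0 mulr0.
  have /he : 0 < sup A - s < e by lra.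
  by rewrite subKr distrC.
move: cv; rewrite le_eqVlt => /predU1P[<-//|cv].
have [|e e0 he] := hr (sup A); first by rewrite uc cv.
(* Halving [e] makes [t < e] strict; the cap [v - sup A] keeps [sup A + t] below [v], hence in
   [A]. *)
pose t := Num.min (e / 2) (v - sup A).
have t0 : 0 < t by rewrite lt_min; lra.
have te : t <= e / 2 by rewrite ge_min lexx.
have tv : t <= v - sup A by rewrite ge_min lexx orbT.
suff : sup A + t <= sup A by lra.
apply: ub_le_sup; first by exists v.
split; first by lra.
apply: step Ac _; rewrite [X in _ <= K * X]addrAC subrr add0r.
by apply: he; lra.
Qed.

Lemma nvariation_cons (R : realType) (X : normedModType R) (u v y : R)
    (g : R -> X) (s : seq R) :
  nvariation u v g (y :: s) = `|g y - g u| + nvariation y v g s.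
Proof. by rewrite /nvariation /= big_nat_recl. Qed.

Lemma lipschitz_nvariation_le (R : realType) (X : normedModType R)
    (g : R -> X) (K u v : R) (s : seq R) :
  (forall p q, u <= p -> p <= q -> q <= v -> `|g q - g p| <= K * (q - p)) ->
  itv_partition u v s -> nvariation u v g s <= K * (v - u).
Proof.
elim: s u => [|y s ih] u hK.
  by move=> [_ /eqP/= <-]; rewrite /nvariation big_geq// subrr mulr0.
move=> [/= /andP[uy ys] lv].
have yv : itv_partition y v s by split.
have yv' := itv_partition_le yv.
have h1 := hK _ _ (lexx u) (ltW uy) yv'.
have h2 : nvariation y v g s <= K * (v - y).
  by apply: ih => // p q yp; apply: hK; apply: le_trans yp; exact: ltW.
rewrite nvariation_cons; lra.
Qed.

(** The one-step partition gives the lower bound, and every partition sum telescopes under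
    [K * (v - u)]; between two reals the supremum is finite. *)
Lemma lipschitz_total_nvariation (R : realType) (X : normedModType R)
    (g : R -> X) (K u v : R) : u < v ->
  (forall p q, u <= p -> p <= q -> q <= v -> `|g q - g p| <= K * (q - p)) ->
  exists2 W : R, total_nvariation u v g = W%:E &
    `|g v - g u| <= W <= K * (v - u).
Proof.
move=> uv hK.
have lo : (`|g v - g u|%:E <= total_nvariation u v g)%E.
  apply: ereal_sup_ubound; exists [:: v]; first exact: itv_partition1.
  by rewrite nvariation_cons /nvariation big_geq// addr0.
have hi : (total_nvariation u v g <= (K * (v - u))%:E)%E.
  apply: ge_ereal_sup => _ [s hs <-].
  by rewrite lee_fin; exact: lipschitz_nvariation_le.
move: lo hi; case: total_nvariation => [W| |]//.
by rewrite !lee_fin => lo hi; exists W; rewrite // lo hi.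
Qed.

(** The upper bound [K] holds for the derivatives at all points near [x], by continuity, and so
    bounds the variation; the lower bound [k] comes from the derivative at [x] alone. *)
Lemma signed_nvariation_bounds {R : realType} {X : normedModType R} {a b : R}
    {g : R -> X} {x k K : R} :
  has_md a b g x -> md_continuous_at a b g x -> k < md a b g x < K ->
  \forall t \near within [set t : R | x + t \in `[a, b]] 0^',
    exists W : R, [/\ signed_nvariation x (x + t) g = W%:E, 0 < `|t| &
      k * `|t| <= `|g (x + t) - g x| <= `|W| /\ `|W| <= K * `|t|].
Proof.
move=> hx [hmd hcont] kLK; have LK : md a b g x < K by case/andP: kLK.
have mdP s : has_md a b g s -> is_md a b g s (md a b g s) by move/getPex.
have [xab xl xr] := mdP _ hx.
have : \forall s \near within `[a, b] (nbhs x),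
    has_md a b g s /\ md a b g s < K.
  apply: filterS2 hmd _; last first.
    by apply: (hcont [set y | y < K]); exact: lt_nbhsl.
  by move=> s.
rewrite near_withinE => /nbhs_ballP[e /= e0 he].
(* The lower bound [md a b g s - 1] is a dummy that completes the two-sided bracket. *)
have {}he s : s \in `[a, b] -> `|x - s| < e -> is_md a b g s (md a b g s) /\
    md a b g s - 1 < md a b g s < K.
  by move=> sab /he /(_ sab)[/mdP ? ->]; split; rewrite // andbT; lra.
have lip u v : a <= u -> u <= v -> v <= b -> `|x - u| < e -> `|x - v| < e ->
    `|g v - g u| <= K * (v - u).
  move=> au uv vb; rewrite !ltr_norml => /andP[xu1 xu2] /andP[xv1 xv2].
  have near_s s : u <= s -> s <= v -> is_md a b g s (md a b g s) /\
      md a b g s - 1 < md a b g s < K.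
    move=> us sv; apply: he; last by rewrite ltr_norml; lra.
    by rewrite in_itv /=; lra.
  apply: locally_lipschitz_le => // s /andP[us sv].
    have [[_ _ sr] sK] := near_s s us (ltW sv).
    have [d d0 hd] := cvg_quotient_at_right_bounds (sr (lt_le_trans sv vb)) sK.
    by exists d => // t /hd /andP[].
  have [[_ sl _] sK] := near_s s (ltW us) sv.
  have [d d0 hd] := cvg_quotient_at_right_bounds (sl (le_lt_trans au us)) sK.
  by exists d => // t /hd /andP[].
(* At an endpoint the claim for the outer side is vacuous, and the radius 1 is arbitrary. *)
have [dr dr0 hdr] : exists2 d : R, 0 < d & x < b -> forall t, 0 < t < d ->
    k * t <= `|g (x + t) - g x|.
  have [xb|] := ltP x b; last by exists 1.
  have [d d0 hd] := cvg_quotient_at_right_bounds (xr xb) kLK.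
  by exists d => // _ t /hd /andP[].
have [dl dl0 hdl] : exists2 d : R, 0 < d & a < x -> forall t, 0 < t < d ->
    k * t <= `|g (x - t) - g x|.
  have [ax|] := ltP a x; last by exists 1.
  have [d d0 hd] := cvg_quotient_at_right_bounds (xl ax) kLK.
  by exists d => // _ t /hd /andP[].
rewrite near_withinE /= near_withinE.
apply/nbhs_ballP; exists (Num.min e (Num.min dr dl)).
  by rewrite /= !lt_min e0 dr0 dl0.
move=> t; rewrite /ball /= sub0r normrN !lt_min => /and3P[te tr tl] t0 xtab.
move: xab xtab; rewrite !in_itv /= => /andP[ax xb] /andP[axt xtb].
move: te tr tl; have [t_gt0|t_lt0|t00] := ltgtP 0 t; last first.
- by rewrite -t00 eqxx in t0.
- rewrite ltr0_norm// => te tr tl.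
  have [||W WE /andP[W1 W2]] := @lipschitz_total_nvariation _ _ g K (x + t) x.
  + lra.
  + move=> p q p1 pq q1; apply: lip; rewrite ?ltr_norml; lra.
  (* For negative [t] the variation is that of [[x + t, x]] with its sign reversed. *)
  exists (- W); rewrite /signed_nvariation leNgt.
  have -> /= : x + t < x by lra.
  have W0 : 0 <= W := le_trans (normr_ge0 _) W1.
  rewrite WE normrN ger0_norm// distrC W1 andbT; split => //; first lra.
  split; last by lra.
  have /hdl : a < x by lra.
  by move=> /(_ (- t)); rewrite opprK distrC; apply; lra.
- rewrite gtr0_norm// => te tr tl.
  have [||W WE /andP[W1 W2]] := @lipschitz_total_nvariation _ _ g K x (x + t).
  + lra.
  + move=> p q p1 pq q1; apply: lip; rewrite ?ltr_norml; lra.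
  exists W; rewrite /signed_nvariation.
  have -> /= : x <= x + t by lra.
  have W0 : 0 <= W := le_trans (normr_ge0 _) W1.
  rewrite WE ger0_norm// W1 andbT; split => //.
  split; last by lra.
  by apply: hdr; lra.
Qed.

Theorem lemma4p3 (R : realType) (X : completeNormedModType R) (a b : R)
    (g : R -> X) (x : R) (hab : a < b) (hx : x \in `[a, b])
    (hmd : has_md a b g x) (hpos : 0 < md a b g x)
    (hcont : md_continuous_at a b g x) :
  metrically_regular a b g x.
Proof.
set L := md a b g x in hpos *.
split.
  (* A positive lower constant forces [W] to be nonzero. *)
  have : L / 2 < L < L + 1 by lra.
  move=> /(signed_nvariation_bounds hmd hcont).
  apply: filterS => t [W [-> t0 [/andP[lo W1] _]]]; split => //.
  by rewrite eqe -normr_gt0; apply: lt_le_trans W1; nra.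
apply/cvgrPdist_le => e e0.
(* The first bound keeps [L - d] positive; the second gives [2 * d <= e * L], whence
   [(1 - e) * (L + d) <= L - d]. *)
pose d := Num.min (L / 2) (e * L / 2).
have d0 : 0 < d by rewrite lt_min; nra.
have d1 : d <= L / 2 by rewrite ge_min lexx.
have d2 : d <= e * L / 2 by rewrite ge_min lexx orbT.
have : L - d < L < L + d by lra.
move=> /(signed_nvariation_bounds hmd hcont).
apply: filterS => t [W [-> t0 [/andP[lo W1] W2]]] /=.
set N := `|g (x + t) - g x| in lo W1 *.
have N0 : 0 < N by apply: lt_le_trans lo; nra.
have W0 : 0 < `|W| by exact: lt_le_trans W1.
have q1 : N / `|W| <= 1 by rewrite ler_pdivrMr// mul1r.
(* As the quotient is at most 1, the goal reduces to [(1 - e) * |W| <= N], which is immediate for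
   [e >= 1]. *)
rewrite ger0_norm ?subr_ge0// lerBlDl -lerBlDr ler_pdivlMr//.
have [e1|e1] := leP 1 e; first by nra.
have h1 : (1 - e) * `|W| <= (1 - e) * ((L + d) * `|t|).
  by rewrite ler_wpM2l// subr_ge0 ltW.
have h2 : (1 - e) * (L + d) <= L - d by nra.
have h3 : (1 - e) * (L + d) * `|t| <= (L - d) * `|t|.
  by rewrite ler_wpM2r// ltW.
lra.
Qed.
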